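(* Let $R$ be a commutative Noetherian local ring and let $C$ be a semidualizing $R$-module. Assume $M$ is a nonzero finitely generated $R$-module that is a test module over $R$, and that $C\text{-}\operatorname{id}(M)<\infty$. If $X$ is a finitely generated $R$-module such that $\operatorname{Ext}^i_R(X,R)=0$ for all $i\gg0$, then $\operatorname{pd}_R(X)<\infty$.
   Context: A finitely generated $R$-module $C$ is semidualizing if the natural map $R\to\operatorname{Hom}_R(C,C)$ is bijective and $\operatorname{Ext}^i_R(C,C)=0$ for all $i\ge1$. The $C$-injective dimension $C\text{-}\operatorname{id}(M)$ is the infimum of the integers $n$ for which there is an exact sequence $0\to M\to\operatorname{Hom}_R(C,I^0)\to\cdots\to\operatorname{Hom}_R(C,I^n)\to0$ with each $I^i$ injective; it is known (Takahashi–White) that $C\text{-}\operatorname{id}(M)=\operatorname{id}_R(C\otimes_RM)$. A finitely generated $R$-module $M$ is a test module if for every finitely generated $R$-module $L$ with $\operatorname{pd}_R(L)=\infty$ one has $\operatorname{Tor}^R_n(M,L)\ne0$ for infinitely many integers $n$. *)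

(* Defs.v *)
From HB Require Import structures.
From mathcomp Require Import all_boot all_order all_algebra.
From mathcomp Require Import generic_quotient ring_quotient boolp.
From mathcomp Require Import freeg.

Set Implicit Arguments.
Unset Strict Implicit.
Unset Printing Implicit Defensive.

Import GRing.Theory.
Local Open Scope ring_scope.
Local Open Scope quotient_scope.

Section Submodules.
Context {R : comNzRingType}.
Implicit Types U V : lmodType R.

Definition submod V (S : submodClosed V) : Type := {x : V | x \in S}.
HB.instance Definition _ V (S : submodClosed V) := SubType.on (submod S).
HB.instance Definition _ V (S : submodClosed V) := Choice.on (submod S).
HB.instance Definition _ V (S : submodClosed V) :=
  [SubChoice_isSubLmodule of submod S by <:].

Definition submod_val V (S : submodClosed V) : {linear submod S -> V} := val.

Definition submod_zmod V (S : submodClosed V) : zmodClosed V :=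
  HB.pack (GRing.SubmodClosed.sort S) (GRing.isZmodClosed.Build V (GRing.SubmodClosed.sort S)
    (GRing.subsemimod_closedB (GRing.subsemimodClosedP S))).

Definition quotmod V (S : submodClosed V) : Type :=
  Quotient.quot (submod_zmod S).
HB.instance Definition _ V (S : submodClosed V) := GRing.Zmodule.on (quotmod S).

Definition quotmod_pi V (S : submodClosed V) : V -> quotmod S :=
  \pi_(Quotient.quot (submod_zmod S)).

Lemma quotmod_piE V (S : submodClosed V) (x y : V) :
  quotmod_pi S x = quotmod_pi S y <-> x - y \in S.
Proof.
rewrite -[x - y \in S]/(x - y \in submod_zmod S) Quotient.idealrBE.
by split=> [/eqP|/eqP].
Qed.

Lemma quotmod_repr V (S : submodClosed V) (q : quotmod S) :
  quotmod_pi S (repr (q : Quotient.quot (submod_zmod S))) = q.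
Proof. exact: reprK. Qed.

Definition quotmod_scale V (S : submodClosed V) (a : R) (q : quotmod S) :
  quotmod S := quotmod_pi S (a *: repr (q : Quotient.quot (submod_zmod S))).

Lemma quotmod_pi_is_additive V (S : submodClosed V) :
  {morph quotmod_pi S : x y / x + y}.
Proof. by move=> x y; rewrite /quotmod_pi piE. Qed.

Lemma quotmod_scale_pi V (S : submodClosed V) a x :
  quotmod_scale a (quotmod_pi S x) = quotmod_pi S (a *: x).
Proof.
apply/quotmod_piE; rewrite -scalerBr rpredZ //.
by apply/quotmod_piE; rewrite quotmod_repr.
Qed.

Section QuotmodScale.
Context (V : lmodType R) (S : submodClosed V).

Lemma quotmod_scaleA a b (q : quotmod S) :
  quotmod_scale a (quotmod_scale b q) = quotmod_scale (a * b) q.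
Proof.
by rewrite -(quotmod_repr q) !quotmod_scale_pi scalerA.
Qed.

Lemma quotmod_scale1 : left_id 1 (@quotmod_scale V S).
Proof. by move=> q; rewrite -(quotmod_repr q) quotmod_scale_pi scale1r. Qed.

Lemma quotmod_scaleDr : right_distributive (@quotmod_scale V S) +%R.
Proof.
move=> a p q; rewrite -(quotmod_repr p) -(quotmod_repr q).
by rewrite -quotmod_pi_is_additive !quotmod_scale_pi -quotmod_pi_is_additive
           scalerDr.
Qed.

Lemma quotmod_scaleDl (q : quotmod S) :
  {morph (@quotmod_scale V S)^~ q : a b / a + b}.
Proof.
move=> a b; rewrite -(quotmod_repr q) !quotmod_scale_pi.
by rewrite -quotmod_pi_is_additive scalerDl.
Qed.

HB.instance Definition _ := GRing.Zmodule_isLmodule.Build R (quotmod S)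
  quotmod_scaleA quotmod_scale1 quotmod_scaleDr quotmod_scaleDl.

Lemma quotmod_pi_is_linear : linear (quotmod_pi S).
Proof. by move=> a x y; rewrite quotmod_pi_is_additive -quotmod_scale_pi. Qed.
HB.instance Definition _ :=
  GRing.isLinear.Build R V (quotmod S) _ (quotmod_pi S) quotmod_pi_is_linear.

Section Lift.
Context (W : lmodType R) (f : {linear V -> W}).
Hypothesis fS : forall x, x \in S -> f x = 0.

Definition quotmod_lift_fun (_ : forall x, x \in S -> f x = 0)
  (q : quotmod S) : W := f (repr (q : Quotient.quot (submod_zmod S))).

Lemma quotmod_lift_funE x : quotmod_lift_fun fS (quotmod_pi S x) = f x.
Proof.
apply/eqP; rewrite -subr_eq0 -linearB fS //.
by apply/quotmod_piE; rewrite quotmod_repr.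
Qed.

Lemma quotmod_lift_is_linear : linear (quotmod_lift_fun fS).
Proof.
move=> a p q; rewrite -(quotmod_repr p) -(quotmod_repr q).
by rewrite -linearP !quotmod_lift_funE linearP.
Qed.
HB.instance Definition _ := GRing.isLinear.Build R (quotmod S) W _
  (quotmod_lift_fun fS) quotmod_lift_is_linear.

Definition quotmod_lift : {linear quotmod S -> W} := quotmod_lift_fun fS.
End Lift.

End QuotmodScale.

Section KerIm.
Context (U V : lmodType R) (f : {linear U -> V}).

Definition ker_pred : pred U := fun x => f x == 0.
Lemma ker_submod : subsemimod_closed ker_pred.
Proof.
split; first split; rewrite ?inE /ker_pred ?unfold_in ?linear0 //.
  by move=> x y /eqP fx /eqP fy; apply/eqP; rewrite linearD fx fy addr0.
by move=> a x /eqP fx; apply/eqP; rewrite linearZ_LR fx scaler0.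
Qed.
Definition kermod : submodClosed U :=
  HB.pack ker_pred (GRing.isSubmodClosed.Build R U ker_pred ker_submod).

Definition im_pred : pred V := fun y => `[< exists x, f x = y >].
Lemma im_submod : subsemimod_closed im_pred.
Proof.
split; first split.
- by apply/asboolP; exists 0; rewrite linear0.
- move=> x y /asboolP[u <-] /asboolP[v <-]; apply/asboolP.
  by exists (u + v); rewrite linearD.
- move=> a x /asboolP[u <-]; apply/asboolP.
  by exists (a *: u); rewrite linearZ_LR.
Qed.
Definition immod : submodClosed V :=
  HB.pack im_pred (GRing.isSubmodClosed.Build R V im_pred im_submod).
End KerIm.

(* The submodule generated by W, as the intersection of those containing W. *)
Section Span.
Context (V : lmodType R) (W : V -> Prop).

Definition span_pred : pred V := fun v =>
  `[< forall S : submodClosed V, (forall w, W w -> w \in S) -> v \in S >].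
Lemma span_submod : subsemimod_closed span_pred.
Proof.
split; first split.
- by apply/asboolP => S _; exact: rpred0.
- move=> x y /asboolP Sx /asboolP Sy; apply/asboolP => S WS.
  by rewrite rpredD ?Sx ?Sy.
- move=> a x /asboolP Sx; apply/asboolP => S WS.
  by rewrite rpredZ ?Sx.
Qed.
Definition submod_span : submodClosed V :=
  HB.pack span_pred (GRing.isSubmodClosed.Build R V span_pred span_submod).

Lemma span_min (S : submodClosed V) :
  (forall w, W w -> w \in S) -> {subset submod_span <= S}.
Proof. by move=> WS v /asboolP; apply. Qed.

Lemma span_gen w : W w -> w \in submod_span.
Proof. by move=> Ww; apply/asboolP => S; apply. Qed.
End Span.

Section Comap.
Context (U V : lmodType R) (f : {linear U -> V}) (S : submodClosed V).

Definition comap_pred : pred U := fun x => f x \in S.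
Lemma comap_submod : subsemimod_closed comap_pred.
Proof.
split; first split.
- by rewrite unfold_in /comap_pred linear0 rpred0.
- by move=> x y Sx Sy; rewrite unfold_in /comap_pred linearD rpredD.
- by move=> a x Sx; rewrite unfold_in /comap_pred linearZ_LR rpredZ.
Qed.
Definition comap : submodClosed U :=
  HB.pack comap_pred
    (GRing.isSubmodClosed.Build R U comap_pred comap_submod).
End Comap.

End Submodules.

Section HomModule.
Context {R : comNzRingType} (U V : lmodType R).

Definition Hom : Type := {linear U -> V}.
HB.instance Definition _ := gen_eqMixin Hom.
HB.instance Definition _ := gen_choiceMixin Hom.

Definition hom_fun (f : Hom) : {linear U -> V} := f.

Lemma homP (f g : Hom) : hom_fun f =1 hom_fun g -> f = g.
Proof.
case: f g => [f [[fA] [fZ]]] [g [[gA] [gZ]]] /= /funext fg.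
rewrite {}fg in fA fZ *.
by rewrite (Prop_irrelevance fA gA) (Prop_irrelevance fZ gZ).
Qed.

Definition hom0 : Hom := (\0 : {linear U -> V}).
Definition homN (f : Hom) : Hom := (\- hom_fun f : {linear U -> V}).
Definition homD (f g : Hom) : Hom :=
  (hom_fun f \+ hom_fun g : {linear U -> V}).
Definition homZ (a : R) (f : Hom) : Hom :=
  (a \*: hom_fun f : {linear U -> V}).

Lemma homDA : associative homD.
Proof. by move=> f g h; apply: homP => x /=; rewrite addrA. Qed.
Lemma homDC : commutative homD.
Proof. by move=> f g; apply: homP => x /=; rewrite addrC. Qed.
Lemma hom0D : left_id hom0 homD.
Proof. by move=> f; apply: homP => x /=; rewrite add0r. Qed.
Lemma homND : left_inverse hom0 homN homD.
Proof. by move=> f; apply: homP => x /=; rewrite addNr. Qed.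
HB.instance Definition _ := GRing.isZmodule.Build Hom homDA homDC hom0D homND.

Lemma homZA a b f : homZ a (homZ b f) = homZ (a * b) f.
Proof. by apply: homP => x /=; rewrite scalerA. Qed.
Lemma hom1Z : left_id 1 homZ.
Proof. by move=> f; apply: homP => x /=; rewrite scale1r. Qed.
Lemma homZDr : right_distributive homZ +%R.
Proof. by move=> a f g; apply: homP => x /=; rewrite scalerDr. Qed.
Lemma homZDl f : {morph homZ^~ f : a b / a + b}.
Proof. by move=> a b; apply: homP => x /=; rewrite scalerDl. Qed.
HB.instance Definition _ :=
  GRing.Zmodule_isLmodule.Build R Hom homZA hom1Z homZDr homZDl.
End HomModule.

Section HomMap.
Context {R : comNzRingType} (A B N : lmodType R) (d : {linear A -> B}).

Definition hom_pre_fun (f : Hom B N) : Hom A N :=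
  (hom_fun f \o d : {linear A -> N}).
Lemma hom_pre_is_linear : linear hom_pre_fun.
Proof. by move=> a f g; apply: homP. Qed.
HB.instance Definition _ :=
  GRing.isLinear.Build R (Hom B N) (Hom A N) _ hom_pre_fun hom_pre_is_linear.
Definition hom_pre : {linear Hom B N -> Hom A N} := hom_pre_fun.
End HomMap.

Section FreeModule.
Context {R : comNzRingType}.

Section Lift.
Context (K : choiceType) (V : lmodType R) (f : K -> V).

Definition freemod_lift_fun : {freeg K / R} -> V := fglift f.
Lemma freemod_lift_is_linear : linear freemod_lift_fun.
Proof.
rewrite /freemod_lift_fun.
have fB := lift_is_additive f.
pose F : {additive {freeg K / R} -> V} :=
  HB.pack (fglift f) (GRing.isZmodMorphism.Build _ _ (fglift f) fB).
move=> a x y; rewrite -[fglift f]/(F : _ -> _) raddfD; congr (_ + _).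
rewrite [a *: x](_ : _ = \sum_(k <- dom x) << a * coeff k x *g k >>) //.
rewrite -[in RHS](freeg_sumE x) !raddf_sum /=.
by apply: eq_bigr => k _; rewrite !liftU scalerA.
Qed.
HB.instance Definition _ := GRing.isLinear.Build R {freeg K / R} V _
  freemod_lift_fun freemod_lift_is_linear.
Definition freemod_lift : {linear {freeg K / R} -> V} := freemod_lift_fun.
End Lift.

Lemma freemod_ext (K : choiceType) (V : lmodType R)
    (f g : {linear {freeg K / R} -> V}) :
  (forall k, f << k >> = g << k >>) -> f =1 g.
Proof.
move=> fg x; rewrite -(freeg_sumE x) !raddf_sum /=; apply: eq_bigr => k _.
have -> : << coeff k x *g k >> = coeff k x *: << k >>.
  by apply/eqP/freeg_eqP => l; rewrite coeffZ !coeffU mul1r.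
by rewrite !linearZ_LR fg.
Qed.

End FreeModule.

Section Tensor.
Context {R : comNzRingType}.
Implicit Types M N V : lmodType R.

Inductive tensor_rel M N : {freeg (M * N)%type / R} -> Prop :=
| TensorRelL a m m' n :
    tensor_rel (<< (a *: m + m', n) >> - (a *: << (m, n) >> + << (m', n) >>))
| TensorRelR a m n n' :
    tensor_rel (<< (m, a *: n + n') >> - (a *: << (m, n) >> + << (m, n') >>)).

Definition tensor M N : lmodType R := quotmod (submod_span (@tensor_rel M N)).

Definition tens M N (m : M) (n : N) : tensor M N := quotmod_pi _ << (m, n) >>.

Section Lift.
Context (M N V : lmodType R) (b : M -> N -> V).
Hypotheses (bl : forall n, linear (b^~ n)) (br : forall m, linear (b m)).

Definition tensor_free_lift : {linear {freeg (M * N)%type / R} -> V} :=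
  freemod_lift (fun p : M * N => b p.1 p.2).

Lemma tensor_free_lift_rel x :
  x \in submod_span (@tensor_rel M N) -> tensor_free_lift x = 0.
Proof.
move=> xW; suff: x \in kermod tensor_free_lift by move/eqP.
apply: span_min xW => w [a m m' n|a m n n']; apply/eqP;
  by rewrite linearB linearP /= /freemod_lift_fun !liftU !scale1r /= ?bl ?br
             subrr.
Qed.

Definition tensor_lift : {linear tensor M N -> V} :=
  quotmod_lift tensor_free_lift_rel.

Lemma tensor_liftE m n : tensor_lift (tens m n) = b m n.
Proof.
have -> : tensor_lift (tens m n) = tensor_free_lift << (m, n) >>.
  exact: quotmod_lift_funE.
by rewrite /= /freemod_lift_fun liftU scale1r.
Qed.
End Lift.

Lemma tens_linearl M N (n : N) : linear (fun m : M => tens m n).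
Proof.
move=> a m m'; rewrite /tens -linearP; apply/quotmod_piE/span_gen.
exact: TensorRelL.
Qed.

Lemma tens_linearr M N (m : M) : linear (fun n : N => tens m n).
Proof.
move=> a n n'; rewrite /tens -linearP; apply/quotmod_piE/span_gen.
exact: TensorRelR.
Qed.

Lemma tensor_map_linearr M N N' (f : {linear N -> N'}) (m : M) :
  linear (fun n => tens m (f n)).
Proof. by move=> a n n'; rewrite linearP tens_linearr. Qed.

Definition tensor_map M N N' (f : {linear N -> N'}) :
    {linear tensor M N -> tensor M N'} :=
  tensor_lift (fun n => @tens_linearl M N' (f n)) (tensor_map_linearr f).

Lemma tensor_mapE M N N' (f : {linear N -> N'}) (m : M) n :
  tensor_map M f (tens m n) = tens m (f n).
Proof. exact: tensor_liftE. Qed.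

Lemma tensor_ext M N V (f g : {linear tensor M N -> V}) :
  (forall m n, f (tens m n) = g (tens m n)) -> f =1 g.
Proof.
move=> fg t; rewrite -(quotmod_repr t); set x := repr _.
rewrite -(freeg_sumE x) !raddf_sum /=; apply: eq_bigr => -[m n] _.
have -> : << coeff (m, n) x *g (m, n) >> = coeff (m, n) x *: << (m, n) >>.
  by apply/eqP/freeg_eqP => k; rewrite coeffZ !coeffU mul1r.
by rewrite !linearZ_LR; congr (_ *: _); apply: fg.
Qed.
End Tensor.

Section Homology.
Context {R : comNzRingType}.

(* ker g / im f, for maps f and g composing to 0. *)
Definition homology (A B C : lmodType R) (f : {linear A -> B})
  (g : {linear B -> C}) : lmodType R :=
  quotmod (comap (submod_val (kermod g)) (immod f)).

Definition is_zero (V : lmodType R) : Prop := forall x : V, x = 0.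

Definition exact_at (A B C : lmodType R) (f : {linear A -> B})
  (g : {linear B -> C}) : Prop :=
  forall y : B, g y = 0 <-> exists x, f x = y.

Lemma homology_eq0 (A B C : lmodType R) (f : {linear A -> B})
  (g : {linear B -> C}) : (forall x, g (f x) = 0) ->
  is_zero (homology f g) <-> exact_at f g.
Proof.
move=> gf0; split=> [H0 y|fg q].
  split=> [gy|[x <-] //]; have ky : y \in kermod g by apply/eqP.
  have := H0 (quotmod_pi _ (Sub y ky : submod (kermod g))).
  rewrite -(linear0 (quotmod_pi _)) => /quotmod_piE.
  by rewrite subr0 => /asboolP.
rewrite -(quotmod_repr q) -(linear0 (quotmod_pi _)); apply/quotmod_piE.
rewrite subr0; set z : submod (kermod g) := repr _.
by apply/asboolP/fg/eqP; exact: (valP z).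
Qed.

End Homology.

Section FreeResolution.
Context {R : comNzRingType} (X : lmodType R).

Definition free_cover (V : lmodType R) : {linear {freeg V / R} -> V} :=
  freemod_lift (idfun : V -> V).

(* The functorial free resolution of X: each term is the free module on the
   underlying set of the previous syzygy.  Ext and Tor below are computed from
   it; another projective resolution gives isomorphic modules. *)
Fixpoint syzygy (n : nat) : lmodType R :=
  if n is m.+1 then submod (kermod (free_cover (syzygy m))) else X.

Definition fres (n : nat) : lmodType R := {freeg (syzygy n) / R}.

Definition fres_aug : {linear fres 0 -> X} := free_cover X.

Definition fres_d (n : nat) : {linear fres n.+1 -> fres n} :=
  submod_val (kermod (free_cover (syzygy n))) \o free_cover (syzygy n.+1).

Lemma free_cover_surj (V : lmodType R) (v : V) : free_cover V << v >> = v.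
Proof. by rewrite /free_cover /= /freemod_lift_fun liftU scale1r. Qed.

Lemma fres_aug_exact : exact_at (fres_d 0) fres_aug.
Proof.
move=> y; split=> [y0|[x <-]].
  have ky : y \in kermod (free_cover (syzygy 0)) by apply/eqP.
  by exists << (Sub y ky : syzygy 1) >>; rewrite /fres_d /= free_cover_surj.
by apply/eqP; exact: (valP (free_cover (syzygy 1) x)).
Qed.

Lemma fres_exact n : exact_at (fres_d n.+1) (fres_d n).
Proof.
move=> y; split=> [y0|[x <-]].
  have ky : y \in kermod (free_cover (syzygy n.+1)) by apply/eqP/val_inj.
  by exists << (Sub y ky : syzygy n.+2) >>; rewrite /fres_d /= free_cover_surj.
rewrite /fres_d /=.
have /eqP -> := valP (free_cover (syzygy n.+2) x).
by [].
Qed.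
End FreeResolution.

Section ExtTor.
Context {R : comNzRingType}.
Implicit Types X M N L : lmodType R.

Definition Ext (n : nat) X N : lmodType R :=
  let delta i : {linear Hom (fres X i) N -> Hom (fres X i.+1) N} :=
    hom_pre N (fres_d X i) in
  if n is m.+1 then homology (delta m) (delta m.+1)
  else homology (\0 : {linear Hom (fres X 0) N -> Hom (fres X 0) N}) (delta 0).

(* Tor is computed from a resolution of the second argument. *)
Definition Tor (n : nat) M L : lmodType R :=
  let d i : {linear tensor M (fres L i.+1) -> tensor M (fres L i)} :=
    tensor_map M (fres_d L i) in
  if n is m.+1 then homology (d m.+1) (d m)
  else homology (d 0)
         (\0 : {linear tensor M (fres L 0) -> tensor M (fres L 0)}).
End ExtTor.

Section Notions.
Context {R : comNzRingType}.
Implicit Types V M C L X : lmodType R.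

Definition finitely_generated V : Prop :=
  exists (n : nat) (g : 'I_n -> V),
    forall v, exists c : 'I_n -> R, v = \sum_i c i *: g i.

Definition injective_module (I : lmodType R) : Prop :=
  forall (A B : lmodType R) (f : {linear A -> B}) (g : {linear A -> I}),
    injective f -> exists h : {linear B -> I}, forall a, h (f a) = g a.

Definition projective_module (P : lmodType R) : Prop :=
  forall (A B : lmodType R) (f : {linear A -> B}) (g : {linear P -> B}),
    (forall b, exists a, f a = b) ->
    exists h : {linear P -> A}, forall p, f (h p) = g p.

(* pd X <= n: a projective resolution of X whose terms vanish above n. *)
Definition pd_le X (n : nat) : Prop :=
  exists (P : nat -> lmodType R) (d : forall i, {linear P i.+1 -> P i})
         (eps : {linear P 0 -> X}),
    [/\ forall i, projective_module (P i),
        forall x, exists p, eps p = x,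
        exact_at (d 0) eps,
        forall i, exact_at (d i.+1) (d i)
      & forall i, (n < i)%N -> is_zero (P i)].

Definition pd_finite X : Prop := exists n, pd_le X n.

(* C-id M <= n: the sequence 0 -> M -> Hom(C, I^0) -> ... -> Hom(C, I^n) -> 0
   is continued by zero terms. *)
Definition Cid_le C M (n : nat) : Prop :=
  exists (I : nat -> lmodType R) (e : {linear M -> Hom C (I 0)})
         (d : forall i, {linear Hom C (I i) -> Hom C (I i.+1)}),
    [/\ forall i, injective_module (I i),
        injective e,
        exact_at e (d 0),
        forall i, exact_at (d i) (d i.+1)
      & forall i, (n < i)%N -> is_zero (I i)].

Definition Cid_finite C M : Prop := exists n, Cid_le C M n.

Definition homothety C (r : R) : Hom C C := (r \*: idfun : {linear C -> C}).

Definition semidualizing C : Prop :=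
  [/\ finitely_generated C,
      bijective (homothety C)
    & forall i, (1 <= i)%N -> is_zero (Ext i C C)].

Definition test_module M : Prop :=
  finitely_generated M /\
  forall L, finitely_generated L -> ~ pd_finite L ->
    forall n0 : nat, exists n, (n0 <= n)%N /\ ~ is_zero (Tor n M L).

Lemma freeg_projective (K : choiceType) : projective_module {freeg K / R}.
Proof.
move=> A B f g fsurj.
have [s fs] := choice (fun k => fsurj (g << k >>)).
exists (freemod_lift s) => x.
pose h : {linear {freeg K / R} -> B} := f \o freemod_lift s.
apply: (@freemod_ext _ _ _ h g) => k.
by rewrite /h /= /freemod_lift_fun liftU scale1r fs.
Qed.

End Notions.

Section RingNotions.
Variable R : comNzRingType.

Definition noetherian_ring : Prop :=
  forall I : submodClosed R^o, finitely_generated (submod I).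

(* MathComp's [idealr R] are the proper ideals of R. *)
Definition maximal_ideal (m : idealr R) : Prop :=
  forall J : idealr R, {subset m <= J} -> {subset J <= m}.

Definition local_ring : Prop :=
  exists m : idealr R, maximal_ideal m /\
    forall m' : idealr R, maximal_ideal m' -> m' =i m.

End RingNotions.

(* Main.v *)
(* For I injective and X finitely generated, Hom evaluation on a resolution of
   X by finitely generated free modules gives
     Tor_i(Hom(C, I), X) = Hom(Ext^i(X, C), I)   for i >= 1,
   so dimension shifting along the finite coresolution of M by the Hom(C, I^k)
   shows that Tor_i(M, X) vanishes for large i as soon as Ext^i(X, C) does; the
   test property then yields pd X < oo.  Taking X = C, this applies because
   Ext^i(C, C) = 0 for i >= 1, hence pd C < oo.  A finite resolution of C by
   finitely generated projectives transfers the vanishing of Ext^i(X, R) for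
   large i to Ext^i(X, C), and the first argument applies to X. *)
From HB Require Import structures.
From mathcomp Require Import all_boot all_order all_algebra.
From mathcomp Require Import boolp freeg.
Require Import Defs.
Import GRing.Theory.
Local Open Scope ring_scope.

Set Implicit Arguments.
Unset Strict Implicit.
Unset Printing Implicit Defensive.

(** * Comparison of projective resolutions, and exactness after [Hom(-, N)] *)

Section Resolutions.
Context {R : comNzRingType}.
Implicit Types A B U V : lmodType R.

Definition linear_of U V (f : U -> V) (fl : linear f) : {linear U -> V} :=
  HB.pack f (GRing.isLinear.Build R U V _ f fl).

Lemma corestrict U V (S : submodClosed V) (f : {linear U -> V}) :
  (forall x, f x \in S) ->
  exists g : {linear U -> submod S}, forall x, val (g x) = f x.
Proof.
move=> fS; pose g x : submod S := Sub (f x) (fS x).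
have gl : linear g by move=> a x y; apply: val_inj; rewrite /= !linearP.
by exists (linear_of gl).
Qed.

(** Both [f] and [u] take values in the kernel of [g], and exactness makes the corestriction of [f]
    to that kernel surjective, so projectivity of [P] applies. *)
Lemma projective_lift (P A B V : lmodType R) (f : {linear A -> B})
    (g : {linear B -> V}) (u : {linear P -> B}) :
  projective_module P -> exact_at f g -> (forall p, g (u p) = 0) ->
  exists h : {linear P -> A}, forall p, f (h p) = u p.
Proof.
move=> projP fg gu.
have [f' f'E] : exists f' : {linear A -> submod (kermod g)},
    forall x, val (f' x) = f x.
  by apply: corestrict => x; apply/eqP/fg; exists x.
have [u' u'E] : exists u' : {linear P -> submod (kermod g)},
    forall x, val (u' x) = u x.
  by apply: corestrict => x; apply/eqP.
have [|h hE] := projP _ _ f' u'.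
  move=> b; have /eqP/fg [a fa] := valP b.
  by exists a; apply: val_inj; rewrite f'E.
by exists h => p; rewrite -f'E hE u'E.
Qed.

Definition projective_resolution (X : lmodType R) (P : nat -> lmodType R)
    (d : forall i, {linear P i.+1 -> P i}) (eps : {linear P 0 -> X}) : Prop :=
  [/\ forall i, projective_module (P i),
      forall x, exists p, eps p = x,
      exact_at (d 0) eps
    & forall i, exact_at (d i.+1) (d i)].

(* The part of the chain maps f : P -> Q, g : Q -> P and of the homotopy h from
   g f to the identity that bears on the (co)homology in degree n + 1. *)
Lemma comparison (X : lmodType R)
    (P : nat -> lmodType R) (d : forall i, {linear P i.+1 -> P i})
    (eps : {linear P 0 -> X})
    (Q : nat -> lmodType R) (e : forall i, {linear Q i.+1 -> Q i})
    (eta : {linear Q 0 -> X}) n :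
  projective_resolution d eps -> projective_resolution e eta ->
  exists (f0 : {linear P n -> Q n}) (f1 : {linear P n.+1 -> Q n.+1})
    (g1 : {linear Q n.+1 -> P n.+1}) (g2 : {linear Q n.+2 -> P n.+2})
    (h0 : {linear P n -> P n.+1}) (h1 : {linear P n.+1 -> P n.+2}),
  [/\ forall x, e n (f1 x) = f0 (d n x),
      forall x, d n.+1 (g2 x) = g1 (e n.+1 x)
    & forall x, x - g1 (f1 x) = d n.+1 (h1 x) + h0 (d n x)].
Proof.
move=> [projP epsS ex0P exP] [projQ etaS ex0Q exQ].
have dd i x : d i (d i.+1 x) = 0 by apply/exP; exists x.
have ee i x : e i (e i.+1 x) = 0 by apply/exQ; exists x.
elim: n => [|n [f1 [f2 [g2 [g3 [h1 [h2 [fE gE hE]]]]]]]].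
  have [f0 f0E] := projP 0 _ _ eta eps etaS.
  have [g0 g0E] := projQ 0 _ _ eps eta epsS.
  have dE x : eps (d 0 x) = 0 by apply/ex0P; exists x.
  have eE x : eta (e 0 x) = 0 by apply/ex0Q; exists x.
  have [|f1 f1E] := projective_lift (u := f0 \o d 0) (projP 1) ex0Q.
    by move=> p /=; rewrite f0E.
  have [|g1 g1E] := projective_lift (u := g0 \o e 0) (projQ 1) ex0P.
    by move=> p /=; rewrite g0E.
  have [|g2 g2E] := projective_lift (u := g1 \o e 1) (projQ 2) (exP 0).
    by move=> p /=; rewrite g1E /= ee linear0.
  have [|h0 h0E] :=
      projective_lift (u := idfun \- (g0 \o f0)) (projP 0) ex0P.
    by move=> p /=; rewrite linearB g0E f0E subrr.
  have [|h1 h1E] := projective_lift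
      (u := (idfun \- (g1 \o f1)) \- (h0 \o d 0)) (projP 1) (exP 0).
    by move=> p /=; rewrite !linearB /= g1E /= f1E h0E /= subrr.
  exists f0, f1, g1, g2, h0, h1; split=> // x.
  by rewrite h1E /= subrK.
(* Each of the three families is lifted one degree further. The digit in a name is the degree the
   map would have for n = 1. *)
have [|f3 f3E] := projective_lift (u := f2 \o d n.+1) (projP n.+2) (exQ n).
  by move=> p /=; rewrite fE dd linear0.
have [|g4 g4E] := projective_lift (u := g3 \o e n.+2) (projQ n.+3) (exP n.+1).
  by move=> p /=; rewrite gE ee linear0.
have [|h3 h3E] := projective_lift
    (u := (idfun \- (g3 \o f3)) \- (h2 \o d n.+1)) (projP n.+2) (exP n.+1).
  move=> p /=; rewrite !linearB /= gE f3E /= hE dd linear0 addr0 subrr //.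
exists f2, f3, g3, g4, h2, h3; split=> // x.
by rewrite h3E /= subrK.
Qed.

Section ExtBalance.
Context (X : lmodType R)
    (P : nat -> lmodType R) (d : forall i, {linear P i.+1 -> P i})
    (eps : {linear P 0 -> X})
    (Q : nat -> lmodType R) (e : forall i, {linear Q i.+1 -> Q i})
    (eta : {linear Q 0 -> X}).
Hypotheses (resP : projective_resolution d eps)
  (resQ : projective_resolution e eta).

(** For a cocycle y on P, y g1 is a cocycle on Q, hence equals w e. Applying y to the homotopy
    identity kills the d h1 term and leaves y = (w f0 + y h0) d. Vanishing of Ext may therefore be
    tested on any projective resolution. *)
Lemma hom_exact_resolution (N : lmodType R) n :
  exact_at (hom_pre N (e n)) (hom_pre N (e n.+1)) ->
  exact_at (hom_pre N (d n)) (hom_pre N (d n.+1)).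
Proof.
have [f0 [f1 [g1 [g2 [h0 [h1 [fE gE hE]]]]]]] := comparison n resP resQ.
have [_ _ _ exP] := resP.
move=> exN y; split=> [y0|[x <-]]; last first.
  apply: homP => p; change (hom_fun x (d n (d n.+1 p)) = 0).
  by rewrite (_ : d n _ = 0) ?linear0 //; apply/exP; exists p.
pose F := hom_fun y.
have y0' p : F (d n.+1 p) = 0.
  by rewrite -[LHS]/(hom_fun (hom_pre N (d n.+1) y) p) y0.
have [|w wE] := (exN (F \o g1 : {linear _ -> _})).1.
  apply: homP => q; change (F (g1 (e n.+1 q)) = 0).
  by rewrite -gE y0'.
exists ((hom_fun w \o f0) \+ (F \o h0) : {linear _ -> _}).
apply: homP => p; change (hom_fun w (f0 (d n p)) + F (h0 (d n p)) = F p).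
rewrite -fE -[hom_fun w _]/(hom_fun (hom_pre N (e n) w) (f1 p)) wE.
change (F (g1 (f1 p)) + F (h0 (d n p)) = F p).
have -> : h0 (d n p) = p - g1 (f1 p) - d n.+1 (h1 p).
  by rewrite hE addrAC subrr add0r.
by rewrite !linearB y0' subr0 addrC subrK.
Qed.

End ExtBalance.
End Resolutions.

(** * Independence of the vanishing of Tor from the resolution *)

Section TorBalance.
Context {R : comNzRingType}.
Implicit Types M X : lmodType R.

Lemma tensor_map_square M (A B B' D : lmodType R) (f : {linear A -> B})
    (g : {linear B -> D}) (f' : {linear A -> B'}) (g' : {linear B' -> D}) :
  (forall x, g (f x) = g' (f' x)) ->
  forall z, tensor_map M g (tensor_map M f z)
          = tensor_map M g' (tensor_map M f' z).
Proof.
move=> fg; pose u : {linear _ -> _} := tensor_map M g \o tensor_map M f.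
pose v : {linear _ -> _} := tensor_map M g' \o tensor_map M f'.
apply: (@tensor_ext _ _ _ _ u v) => m x.
rewrite -[LHS]/(tensor_map M g (tensor_map M f (tens m x))).
rewrite -[RHS]/(tensor_map M g' (tensor_map M f' (tens m x))).
by rewrite !tensor_mapE fg.
Qed.

Lemma tensor_map_comp0 M (A B D : lmodType R) (f : {linear A -> B})
    (g : {linear B -> D}) :
  (forall x, g (f x) = 0) ->
  forall z, tensor_map M g (tensor_map M f z) = 0.
Proof.
move=> gf; pose u : {linear _ -> _} := tensor_map M g \o tensor_map M f.
apply: (@tensor_ext _ _ _ _ u \0) => m x.
rewrite -[LHS]/(tensor_map M g (tensor_map M f (tens m x))) !tensor_mapE gf.
exact: (linear0 (linear_of (tens_linearr m))).
Qed.

(** For a cycle z, f1 z is a boundary e w, and the homotopy identity tensored with [M] gives z = g1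
    f1 z + d h1 z = d (g2 w + h1 z). *)
Lemma tensor_exact_resolution (X : lmodType R)
    (P : nat -> lmodType R) (d : forall i, {linear P i.+1 -> P i})
    (eps : {linear P 0 -> X})
    (Q : nat -> lmodType R) (e : forall i, {linear Q i.+1 -> Q i})
    (eta : {linear Q 0 -> X}) M n :
  projective_resolution d eps -> projective_resolution e eta ->
  exact_at (tensor_map M (e n.+1)) (tensor_map M (e n)) ->
  exact_at (tensor_map M (d n.+1)) (tensor_map M (d n)).
Proof.
move=> resP resQ exM.
have [f0 [f1 [g1 [g2 [h0 [h1 [fE gE hE]]]]]]] := comparison n resP resQ.
have [_ _ _ exP] := resP.
have dd x : d n (d n.+1 x) = 0 by apply/exP; exists x.
move=> z; split=> [z0|[x <-]]; last exact: tensor_map_comp0.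
have [|w wE] := (exM (tensor_map M f1 z)).1.
  by rewrite (tensor_map_square fE) z0 linear0.
exists (tensor_map M g2 w + tensor_map M h1 z).
rewrite linearD (tensor_map_square gE) wE.
pose u : {linear _ -> _} := (tensor_map M g1 \o tensor_map M f1) \+
  ((tensor_map M (d n.+1) \o tensor_map M h1) \+
   (tensor_map M h0 \o tensor_map M (d n))).
transitivity (u z).
  by rewrite -[u z]/(_ + (_ + tensor_map M h0 (tensor_map M (d n) z)))
             z0 linear0 addr0.
apply: (@tensor_ext _ _ _ _ u idfun) => m x.
rewrite -[u _]/(tensor_map M g1 (tensor_map M f1 (tens m x)) +
  (tensor_map M (d n.+1) (tensor_map M h1 (tens m x)) +
   tensor_map M h0 (tensor_map M (d n) (tens m x)))) !tensor_mapE.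
pose t := linear_of (@tens_linearr R M (P n.+1) m).
rewrite -[LHS]/(t _ + (t _ + t _)) -!linearD -hE addrC subrK //.
Qed.
End TorBalance.

(** * Resolutions by finitely generated free modules over a Noetherian ring *)

Section Finiteness.
Context {R : comNzRingType}.
Implicit Types A B D V W X : lmodType R.

(** Generators of the kernel together with preimages of generators of the image generate [V]. *)
Lemma fg_extension V W (f : {linear V -> W}) :
  finitely_generated (submod (kermod f)) ->
  finitely_generated (submod (immod f)) -> finitely_generated V.
Proof.
move=> [n [g gE]] [m [h hE]].
have [h' h'E] : exists h' : 'I_m -> V, forall i, f (h' i) = val (h i).
  have hE' i : exists y, f y = val (h i) by have /asboolP := valP (h i).
  by have [h' h'E] := choice hE'; exists h'.
pose G (i : 'I_(n + m)) :=
  match split i with inl i => val (g i) | inr i => h' i end.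
exists (n + m)%N, G => v.
have fv : f v \in immod f by apply/asboolP; exists v.
have [c /(congr1 val)/= cE] := hE (Sub (f v) fv).
pose r := v - \sum_i c i *: h' i.
have rk : r \in kermod f.
  apply/eqP; rewrite linearB linear_sum cE.
  rewrite -[X in X - _]/(submod_val (immod f) _) linear_sum.
  rewrite -sumrB big1 // => i _; rewrite linearZ_LR [f _]linearZ_LR h'E.
  exact: subrr.
have [b /(congr1 val)/= bE] := gE (Sub r rk).
exists (fun i => match split i with inl i => b i | inr i => c i end).
rewrite big_split_ord /=.
rewrite (eq_bigr (fun i => b i *: val (g i))); last first.
  by move=> i _; rewrite /G -[lshift m i]/(unsplit (inl i)) unsplitK.
rewrite [X in _ + X](eq_bigr (fun i => c i *: h' i)); last first.
  by move=> i _; rewrite /G -[rshift n i]/(unsplit (inr i)) unsplitK.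
apply/eqP; rewrite -subr_eq -/r; apply/eqP.
rewrite bE -[LHS]/(submod_val (kermod f) _) linear_sum.
by apply: eq_bigr => i _; rewrite linearZ_LR.
Qed.

(** Induction on the number of coordinates: the image of the last one is an ideal, finitely
    generated by hypothesis, and its kernel is separated by the remaining ones. *)
Lemma fg_of_coordinates (Rnoeth : noetherian_ring R) (k : nat) V
    (f : nat -> {linear V -> R^o}) :
  (forall x, (forall j, (j < k)%N -> f j x = 0) -> x = 0) ->
  finitely_generated V.
Proof.
elim: k V f => [|k IHk] V f fI.
  exists 0%N, (fun=> 0) => v; exists (fun=> 0).
  by rewrite big_ord0 (fI v).
apply: (fg_extension (f := f k)); last exact: Rnoeth.
apply: (IHk _ (fun j => f j \o submod_val (kermod (f k)))) => x xE.
apply: val_inj; apply: fI => j; rewrite ltnS leq_eqVlt => /orP[/eqP->|/xE//].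
by apply/eqP; exact: (valP x).
Qed.

Lemma freeg_ord_sumE n (x : {freeg 'I_n / R}) : x = \sum_i coeff i x *: << i >>.
Proof.
apply/eqP/freeg_eqP => j; rewrite raddf_sum (bigD1 j) //= coeffZ coeffU eqxx.
rewrite !mulr1 big1 ?addr0 // => i ij; rewrite coeffZ coeffU (negbTE ij).
by rewrite !mulr0.
Qed.

Lemma coeff_is_linear n (i : 'I_n) :
  linear (fun x : {freeg 'I_n / R} => coeff i x : R^o).
Proof. by move=> a x y; rewrite coeffD coeffZ. Qed.

Lemma fg_submod_free (Rnoeth : noetherian_ring R) n
    (S : submodClosed {freeg 'I_n / R}) : finitely_generated (submod S).
Proof.
(* Rank 0 is treated apart because [inord], used below to index the coordinates by [nat], needs a
   nonempty ordinal type. *)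
case: n S => [|n] S.
  exists 0%N, (fun=> 0) => v; exists (fun=> 0); rewrite big_ord0.
  by apply: val_inj; rewrite [LHS]freeg_ord_sumE big_ord0.
apply: (@fg_of_coordinates Rnoeth n.+1 _
  (fun j => linear_of (coeff_is_linear (inord j)) \o submod_val S)) => x xE.
apply: val_inj; rewrite [LHS]freeg_ord_sumE big1 // => i _.
by rewrite -(inord_val i) [coeff _ _](xE i (ltn_ord i)) scale0r.
Qed.

(* A chosen finite generating family; junk (the empty family) when V is not
   finitely generated. *)
Definition gens V : {n : nat & 'I_n -> V} :=
  match pselect (finitely_generated V) with
  | left fg => let: exist n Pn := cid fg in existT _ n (projT1 (cid Pn))
  | right _ => existT _ 0%N (fun=> 0)
  end.

Definition finite_free V : lmodType R := {freeg 'I_(projT1 (gens V)) / R}.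

Definition finite_cover V : {linear finite_free V -> V} :=
  freemod_lift (projT2 (gens V)).

Lemma finite_cover_surj V :
  finitely_generated V -> forall v, exists x, finite_cover V x = v.
Proof.
rewrite /finite_cover /finite_free /gens; case: pselect => // fg _ v.
case: cid => n Pn /=; case: cid => g /= /(_ v)[c ->].
exists (\sum_i c i *: << i >>); rewrite linear_sum; apply: eq_bigr => i _.
by rewrite linearZ_LR /= /freemod_lift_fun liftU scale1r.
Qed.

(** Total in [X]: the recursion carries no proof of finite generation, which [fsyz_fg] supplies
    afterwards. *)
Fixpoint fsyz X (n : nat) : lmodType R :=
  if n is m.+1 then submod (kermod (finite_cover (fsyz X m))) else X.

Definition ffres X (n : nat) : lmodType R := finite_free (fsyz X n).

Definition ffres_d X (n : nat) : {linear ffres X n.+1 -> ffres X n} :=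
  submod_val (kermod (finite_cover (fsyz X n))) \o finite_cover (fsyz X n.+1).

Lemma fsyz_fg (Rnoeth : noetherian_ring R) X n :
  finitely_generated X -> finitely_generated (fsyz X n).
Proof. by case: n => // n _; exact: fg_submod_free. Qed.

(** Stated for an arbitrary cover of a kernel, so as to serve both at the augmentation and in higher
    degrees of [ffres_resolution]. *)
Lemma kermod_cover_exact A B D (f : {linear A -> B})
    (g : {linear D -> submod (kermod f)}) :
  (forall y, exists x, g x = y) ->
  forall y, f y = 0 <-> exists x, submod_val (kermod f) (g x) = y.
Proof.
move=> gsurj y; split=> [/eqP y0|[x <-]]; last first.
  by apply/eqP; exact: (valP (g x)).
by have [x xE] := gsurj (Sub y y0); exists x; rewrite xE.
Qed.

Lemma ffres_resolution (Rnoeth : noetherian_ring R) X :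
  finitely_generated X ->
  projective_resolution (ffres_d X) (finite_cover X).
Proof.
move=> Xfg; have surj n := finite_cover_surj (fsyz_fg Rnoeth n Xfg).
split=> [i|||n y]; [exact: freeg_projective | exact: (surj 0%N) | | ].
  exact: (kermod_cover_exact (surj 1%N)).
(* It remains to see that the differential and the cover it factors through have the same kernel,
   the inclusion of the syzygy being injective. *)
rewrite -(kermod_cover_exact (surj n.+2) y).
split=> [y0|y0]; first by apply: val_inj.
by rewrite -[LHS]/(submod_val _ (finite_cover (fsyz X n.+1) y)) y0.
Qed.

Lemma fres_resolution X : projective_resolution (fres_d X) (fres_aug X).
Proof.
split=> [i|x||i]; [exact: freeg_projective | | exact: fres_aug_exact
  | exact: fres_exact].
by exists << x >>; exact: free_cover_surj.
Qed.
End Finiteness.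

(** * The isomorphism of [tensor M F] with n copies of [M], for F free of rank n *)

Section TensorCoordinates.
Context {R : comNzRingType} (M : lmodType R) (n : nat).
Local Notation F := {freeg 'I_n / R}.

Lemma tensor_coord_linearl k (x : F) : linear (fun m : M => coeff k x *: m).
Proof. by move=> a m m'; rewrite scalerDr !scalerA mulrC. Qed.

Lemma tensor_coord_linearr k (m : M) : linear (fun x : F => coeff k x *: m).
Proof. by move=> a x y; rewrite coeffD coeffZ scalerDl scalerA. Qed.

Definition tensor_coord k : {linear tensor M F -> M} :=
  tensor_lift (tensor_coord_linearl k) (tensor_coord_linearr k).

Lemma tensor_coordE k m x : tensor_coord k (tens m x) = coeff k x *: m.
Proof. exact: tensor_liftE. Qed.

Lemma tensor_coord_sum (z : tensor M F) :
  z = \sum_k tens (tensor_coord k z) << k >>.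
Proof.
pose u (z : tensor M F) := \sum_k tens (tensor_coord k z) (<< k >> : F).
have ul : linear u.
  move=> a x y; rewrite /u scaler_sumr -big_split; apply: eq_bigr => k _.
  by rewrite linearP tens_linearl.
symmetry; apply: (@tensor_ext _ _ _ _ (linear_of ul) idfun) => m x.
rewrite -[LHS]/(u _) -[RHS]/(tens m x) /u.
rewrite [in RHS](freeg_ord_sumE x) -[RHS]/(linear_of (tens_linearr m) _).
rewrite linear_sum; apply: eq_bigr => k _; rewrite tensor_coordE.
rewrite -[LHS]/(linear_of (tens_linearl (<< k >> : F)) (coeff k x *: m)).
by rewrite !linearZ_LR.
Qed.

Lemma tensor_coord_eq0 (z : tensor M F) :
  (forall k, tensor_coord k z = 0) -> z = 0.
Proof.
move=> z0; rewrite [LHS]tensor_coord_sum big1 // => k _; rewrite z0.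
exact: (linear0 (linear_of (tens_linearl (<< k >> : F)))).
Qed.

End TensorCoordinates.
Arguments tensor_coord {R M n} k.

(** * Dimension shifting for Tor along a finite coresolution *)

Section TensorFinitelyFree.
Context {R : comNzRingType}.
Implicit Types M : lmodType R.

Section TensorMapLeft.
Context (M M' : lmodType R) (f : {linear M -> M'}) (V : lmodType R).

Lemma tensor_mapl_linearl (v : V) : linear (fun m => tens (f m) v).
Proof. by move=> a m m'; rewrite linearP tens_linearl. Qed.

Definition tensor_mapl : {linear tensor M V -> tensor M' V} :=
  tensor_lift tensor_mapl_linearl (fun m => tens_linearr (f m)).

Lemma tensor_maplE m v : tensor_mapl (tens m v) = tens (f m) v.
Proof. exact: tensor_liftE. Qed.
End TensorMapLeft.

Lemma tensor_mapl_map (M M' : lmodType R) (f : {linear M -> M'})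
    (A B : lmodType R) (g : {linear A -> B}) z :
  tensor_mapl f B (tensor_map M g z) = tensor_map M' g (tensor_mapl f A z).
Proof.
pose u : {linear _ -> _} := tensor_mapl f B \o tensor_map M g.
pose v : {linear _ -> _} := tensor_map M' g \o tensor_mapl f A.
apply: (@tensor_ext _ _ _ _ u v) => m x.
rewrite -[LHS]/(tensor_mapl f B (tensor_map M g (tens m x))).
rewrite -[RHS]/(tensor_map M' g (tensor_mapl f A (tens m x))).
by rewrite tensor_mapE !tensor_maplE tensor_mapE.
Qed.

Lemma tensor_mapl_coord (M M' : lmodType R) (f : {linear M -> M'}) n k
    (z : tensor M {freeg 'I_n / R}) :
  tensor_coord k (tensor_mapl f _ z) = f (tensor_coord k z).
Proof.
pose u : {linear _ -> _} := tensor_coord k \o tensor_mapl f {freeg 'I_n / R}.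
pose v : {linear _ -> _} := f \o @tensor_coord R M n k.
apply: (@tensor_ext _ _ _ _ u v) => m x.
rewrite -[LHS]/(tensor_coord k (tensor_mapl f _ (tens m x))).
rewrite -[RHS]/(f (tensor_coord k (tens m x))).
by rewrite tensor_maplE !tensor_coordE linearZ_LR.
Qed.

Lemma tensor_mapl_sum (M M' : lmodType R) (f : {linear M -> M'}) n
    (b : 'I_n -> M) :
  tensor_mapl f _ (\sum_k tens (b k) (<< k >> : {freeg 'I_n / R}))
  = \sum_k tens (f (b k)) << k >>.
Proof.
by rewrite linear_sum; apply: eq_bigr => k _; rewrite tensor_maplE.
Qed.

Lemma tensor_mapl_inj (M M' : lmodType R) (f : {linear M -> M'}) n z :
  injective f -> tensor_mapl f {freeg 'I_n / R} z = 0 -> z = 0.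
Proof.
move=> finj z0; apply: tensor_coord_eq0 => k; apply: finj.
by rewrite linear0 -tensor_mapl_coord z0 linear0.
Qed.

Lemma tensor_mapl_surj (M M' : lmodType R) (f : {linear M -> M'}) n :
  (forall y, exists x, f x = y) ->
  forall y, exists x, tensor_mapl f {freeg 'I_n / R} x = y.
Proof.
move=> fsurj y; have [b bE] := choice (fun k => fsurj (tensor_coord k y)).
exists (\sum_k tens (b k) << k >>); rewrite tensor_mapl_sum.
by rewrite [RHS]tensor_coord_sum; apply: eq_bigr => k _; rewrite bE.
Qed.

Lemma tensor_mapl_exact (M M' M'' : lmodType R) (f : {linear M -> M'})
    (g : {linear M' -> M''}) n z :
  exact_at f g -> tensor_mapl g {freeg 'I_n / R} z = 0 ->
  exists x, tensor_mapl f _ x = z.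
Proof.
move=> fg gz; have fz k : exists b, f b = tensor_coord k z.
  by apply/fg; rewrite -tensor_mapl_coord gz linear0.
have [b bE] := choice fz; exists (\sum_k tens (b k) << k >>).
rewrite tensor_mapl_sum [RHS]tensor_coord_sum.
by apply: eq_bigr => k _; rewrite bE.
Qed.

(** This is the piece Tor_{k+1}(M'') -> Tor_k(M') -> Tor_k(M) of the long exact sequence. For a
    cycle z, write i z = d2 w; then p w is a cycle, hence d3 v. Lifting v to v' over [M], the
    element w - d3 v' comes from some w' over [M'], and d2 w' = z. *)
Lemma tensor_exact_shift (M' M M'' : lmodType R) (i : {linear M' -> M})
    (p : {linear M -> M''}) n0 n1 n2 n3
    (d1 : {linear {freeg 'I_n1 / R} -> {freeg 'I_n0 / R}})
    (d2 : {linear {freeg 'I_n2 / R} -> {freeg 'I_n1 / R}})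
    (d3 : {linear {freeg 'I_n3 / R} -> {freeg 'I_n2 / R}}) :
  injective i -> exact_at i p -> (forall y, exists x, p x = y) ->
  (forall x, d1 (d2 x) = 0) -> (forall x, d2 (d3 x) = 0) ->
  exact_at (tensor_map M d2) (tensor_map M d1) ->
  exact_at (tensor_map M'' d3) (tensor_map M'' d2) ->
  exact_at (tensor_map M' d2) (tensor_map M' d1).
Proof.
move=> iinj ip psurj d12 d23 exM exM'' z.
split=> [z0|[x <-]]; last exact: tensor_map_comp0.
have [|w wE] := (exM (tensor_mapl i _ z)).1.
  by rewrite -tensor_mapl_map z0 linear0.
have [|v vE] := (exM'' (tensor_mapl p _ w)).1.
  rewrite -tensor_mapl_map wE; apply: tensor_coord_eq0 => k.
  by rewrite !tensor_mapl_coord; apply/ip; exists (tensor_coord k z).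
have [v' v'E] := tensor_mapl_surj psurj v.
have [|w' w'E] := tensor_mapl_exact (z := w - tensor_map M d3 v') ip.
  by rewrite linearB tensor_mapl_map v'E vE subrr.
exists w'; apply/eqP; rewrite -subr_eq0; apply/eqP.
apply: (tensor_mapl_inj iinj); rewrite linearB tensor_mapl_map w'E linearB wE.
by rewrite tensor_map_comp0 // subr0 subrr.
Qed.

(** Induction on the length, with [M] varying. The cokernel of [i] is the kernel of [d 1], which has
    a coresolution one term shorter. The bound [n0] does not grow, since the shift uses the cokernel
    in a higher degree. *)
Lemma tensor_exact_coresolution (r : nat -> nat)
    (e : forall i, {linear {freeg 'I_(r i.+1) / R} -> {freeg 'I_(r i) / R}})
    (ee : forall i x, e i (e i.+1 x) = 0) n0 n M (J : nat -> lmodType R)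
    (i : {linear M -> J 0}) (d : forall k, {linear J k -> J k.+1}) :
  injective i -> exact_at i (d 0) ->
  (forall k, exact_at (d k) (d k.+1)) ->
  (forall k, (n <= k)%N -> is_zero (J k)) ->
  (forall k j, (n0 <= j)%N ->
     exact_at (tensor_map (J k) (e j.+1)) (tensor_map (J k) (e j))) ->
  forall j, (n0 <= j)%N ->
    exact_at (tensor_map M (e j.+1)) (tensor_map M (e j)).
Proof.
elim: n M J i d => [|n IHn] M J i d iinj ex0 ex J0 exJ j j0.
  (* When all the [J k] vanish, [M] embeds in zero. *)
  have M0 : is_zero M.
    by move=> x; apply: iinj; rewrite (J0 0%N _ (i x)) // linear0.
  move=> z; split=> [_|[x <-]]; last exact: (tensor_map_comp0 (ee j)).
  have -> : z = 0 by apply: tensor_coord_eq0 => k; exact: M0.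
  by exists 0; rewrite linear0.
pose K := submod (kermod (d 1)).
have [p pE] : exists p : {linear J 0 -> K}, forall x, val (p x) = d 0 x.
  by apply: corestrict => x; apply/eqP/ex; exists x.
have exK : exact_at (tensor_map K (e j.+2)) (tensor_map K (e j.+1)).
  apply: (IHn K (J \o succn) (submod_val (kermod (d 1))) (fun k => d k.+1)).
  - exact: val_inj.
  - move=> y; split=> [y0|[x <-]]; last by apply/eqP; exact: (valP x).
    by have y0' : y \in kermod (d 1) by [apply/eqP]; exists (Sub y y0').
  - by move=> k; exact: ex.
  - by move=> k nk; exact: J0.
  - by move=> k j' j0'; exact: exJ.
  - exact: leq_trans j0 _.
apply: (tensor_exact_shift iinj _ _ _ _ (exJ 0%N j j0) exK) => //.
- move=> y; split=> [y0|/ex0 y0]; last first.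
    by apply: val_inj; exact: etrans (pE y) y0.
  by apply/ex0; rewrite -pE y0.
- move=> y; have /eqP/ex[x xE] := valP y.
  by exists x; apply: val_inj; exact: etrans (pE x) xE.
Qed.
End TensorFinitelyFree.

(** * Hom evaluation and duality into an injective module *)

Section HomEvaluation.
Context {R : comNzRingType}.
Implicit Types A B C I : lmodType R.

(** A map [y] killing im f = ker g factors through the image of [g], and injectivity of [I] extends
    the factor to [D]. *)
Lemma injective_hom_exact (I A B D : lmodType R) (f : {linear A -> B})
    (g : {linear B -> D}) :
  injective_module I -> exact_at f g ->
  exact_at (hom_pre I g) (hom_pre I f).
Proof.
move=> injI fg y; split=> [y0|[x <-]]; last first.
  apply: homP => a; rewrite -[LHS]/(hom_fun x (g (f a))).
  by rewrite (_ : g _ = 0) ?linear0 //; apply/fg; exists a.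
have yE b b' : g b = g b' -> hom_fun y b = hom_fun y b'.
  move=> /eqP; rewrite -subr_eq0 -linearB => /eqP/fg[a aE].
  apply/eqP; rewrite -subr_eq0 -linearB -aE.
  by rewrite -[hom_fun y _]/(hom_fun (hom_pre I f y) a) y0.
have pre (z : submod (immod g)) : exists b, g b = val z.
  by have /asboolP := valP z.
have [s sE] := choice pre.
(* The section [s] is only set-theoretic; composing with [y] makes it linear because [y] is constant
   on the fibres of [g]. *)
have sl : linear (fun z => hom_fun y (s z)).
  move=> a z z'; rewrite -linearP; apply: yE.
  by rewrite linearP !sE.
have [h hE] := injI _ _ (submod_val (immod g)) (linear_of sl) val_inj.
exists (h : Hom D I); apply: homP => b.
rewrite -[LHS]/(h (g b)); have gb : g b \in immod g by apply/asboolP; exists b.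
rewrite -[g b]/(submod_val (immod g) (Sub (g b) gb)) hE.
by apply: yE; rewrite sE.
Qed.

Lemma hom_at_linear A C (x : A) : linear (fun phi : Hom A C => hom_fun phi x).
Proof. by []. Qed.

Lemma hom_sumE A C (J : Type) (s : seq J) (G : J -> Hom A C) x :
  hom_fun (\sum_(j <- s) G j) x = \sum_(j <- s) hom_fun (G j) x.
Proof. exact: (linear_sum (linear_of (@hom_at_linear A C x))). Qed.

Section Map.
Context (C I A : lmodType R).

Definition hom_eval_fun (a : Hom C I) (x : A) : Hom (Hom A C) I :=
  hom_fun a \o linear_of (@hom_at_linear A C x).

Lemma hom_eval_linearl (x : A) : linear (hom_eval_fun^~ x).
Proof. by move=> c a b; apply: homP. Qed.

Lemma hom_eval_linearr (a : Hom C I) : linear (hom_eval_fun a).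
Proof.
move=> c x y; apply: homP => phi.
rewrite -[LHS]/(hom_fun a (hom_fun phi (c *: x + y))).
by rewrite !linearP.
Qed.

Definition hom_eval : {linear tensor (Hom C I) A -> Hom (Hom A C) I} :=
  tensor_lift hom_eval_linearl hom_eval_linearr.

Lemma hom_evalE a x phi :
  hom_fun (hom_eval (tens a x)) phi = hom_fun a (hom_fun phi x).
Proof. by rewrite /hom_eval tensor_liftE. Qed.
End Map.

Lemma hom_eval_natural C I A B (d : {linear A -> B}) z :
  hom_eval C I B (tensor_map _ d z)
  = hom_pre I (hom_pre C d) (hom_eval C I A z).
Proof.
pose u : {linear _ -> _} := hom_eval C I B \o tensor_map (Hom C I) d.
pose v : {linear _ -> _} := hom_pre I (hom_pre C d) \o hom_eval C I A.
apply: (@tensor_ext _ _ _ _ u v) => a x; apply: homP => phi.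
rewrite -[u _]/(hom_eval C I B (tensor_map _ d (tens a x))) tensor_mapE.
rewrite hom_evalE.
by rewrite -[RHS]/(hom_fun (hom_eval C I A (tens a x)) (hom_pre C d phi))
           hom_evalE.
Qed.

Section FinitelyFree.
Context (C I : lmodType R) (n : nat).
Local Notation F := {freeg 'I_n / R}.

(** The k-th inclusion of [C] in [Hom F C], viewed as n copies of [C]. These maps test injectivity
    of [hom_eval] and build its preimages. *)
Definition hom_unit (k : 'I_n) (c : C) : Hom F C :=
  freemod_lift (fun j => if j == k then c else 0).

Lemma hom_unitE k c j :
  hom_fun (hom_unit k c) << j >> = if j == k then c else 0.
Proof. by rewrite /hom_unit /= /freemod_lift_fun liftU scale1r. Qed.

Lemma hom_free_ext (phi psi : Hom F C) :
  (forall k, hom_fun phi << k >> = hom_fun psi << k >>) -> phi = psi.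
Proof. by move=> E; apply: homP; exact: freemod_ext. Qed.

Lemma hom_unit_linear k : linear (hom_unit k).
Proof.
move=> a c c'; apply: hom_free_ext => j.
rewrite -[RHS]/(a *: hom_fun (hom_unit k c) << j >>
                + hom_fun (hom_unit k c') << j >>).
by rewrite !hom_unitE; case: eqP; rewrite // scaler0 addr0.
Qed.

Lemma hom_unit_sum (phi : Hom F C) :
  phi = \sum_k hom_unit k (hom_fun phi << k >>).
Proof.
apply: hom_free_ext => j.
rewrite hom_sumE (bigD1 j) //= big1 ?addr0 ?hom_unitE ?eqxx // => k kj.
by rewrite hom_unitE eq_sym (negbTE kj).
Qed.

Lemma hom_eval_sumE (z : tensor (Hom C I) F) phi :
  hom_fun (hom_eval C I F z) phi
  = \sum_k hom_fun (tensor_coord k z) (hom_fun phi << k >>).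
Proof.
rewrite {1}(tensor_coord_sum z) linear_sum hom_sumE; apply: eq_bigr => k _.
exact: hom_evalE.
Qed.

Lemma hom_eval_inj (z : tensor (Hom C I) F) : hom_eval C I F z = 0 -> z = 0.
Proof.
move=> z0; apply: tensor_coord_eq0 => k; apply: homP => c.
have := hom_eval_sumE z (hom_unit k c); rewrite z0 (bigD1 k) //=.
rewrite big1 ?addr0; first by rewrite hom_unitE eqxx.
by move=> j jk; rewrite hom_unitE (negbTE jk) linear0.
Qed.

Lemma hom_eval_surj (w : Hom (Hom F C) I) : exists z, hom_eval C I F z = w.
Proof.
pose a k : Hom C I := hom_fun w \o linear_of (hom_unit_linear k).
exists (\sum_k tens (a k) << k >>); apply: homP => phi.
rewrite [in RHS](hom_unit_sum phi) !linear_sum hom_sumE.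
by apply: eq_bigr => k _; rewrite hom_evalE.
Qed.
End FinitelyFree.

(** [hom_eval] is natural, and bijective on finite free modules, so it identifies the tensored
    complex with the double dual one, which is exact by [injective_hom_exact]. *)
Lemma tensor_exact_of_hom_exact C I n0 n1 n2
    (d1 : {linear {freeg 'I_n1 / R} -> {freeg 'I_n0 / R}})
    (d2 : {linear {freeg 'I_n2 / R} -> {freeg 'I_n1 / R}}) :
  injective_module I -> (forall x, d1 (d2 x) = 0) ->
  exact_at (hom_pre C d1) (hom_pre C d2) ->
  exact_at (tensor_map (Hom C I) d2) (tensor_map (Hom C I) d1).
Proof.
move=> injI d12 exC z; split=> [z0|[x <-]]; last exact: tensor_map_comp0.
have [|w wE] := (injective_hom_exact injI exC (hom_eval C I _ z)).1.
  by rewrite -hom_eval_natural z0 linear0.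
have [u uE] := hom_eval_surj w; exists u.
apply/eqP; rewrite -subr_eq0; apply/eqP; apply: hom_eval_inj.
by rewrite linearB hom_eval_natural uE wE subrr.
Qed.
End HomEvaluation.

(** * Passing from coefficients in R to coefficients of finite projective dimension *)

Section ExtCoefficients.
Context {R : comNzRingType}.
Implicit Types N : lmodType R.

Lemma hom_pre_comp0 N (A B D : lmodType R) (d : {linear A -> B})
    (e : {linear D -> A}) :
  (forall x, d (e x) = 0) -> forall y, hom_pre N e (hom_pre N d y) = 0.
Proof.
move=> de y; apply: homP => x; rewrite -[LHS]/(hom_fun y (d (e x))) de.
exact: linear0.
Qed.

(** This is the piece Ext^k(N) -> Ext^k(N'') -> Ext^{k+1}(N') of the long exact sequence. Lift y to
    f : P1 -> N; then f d1 = i g with g a cocycle, so g = h d1. The cocycle f - i h equals k d0, and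
    p k is the required map. *)
Lemma hom_exact_shift (N' N N'' : lmodType R) (i : {linear N' -> N})
    (p : {linear N -> N''}) (P0 P1 P2 P3 : lmodType R)
    (d0 : {linear P1 -> P0}) (d1 : {linear P2 -> P1})
    (d2 : {linear P3 -> P2}) :
  projective_module P1 -> projective_module P2 ->
  injective i -> exact_at i p -> (forall y, exists x, p x = y) ->
  (forall x, d0 (d1 x) = 0) -> (forall x, d1 (d2 x) = 0) ->
  exact_at (hom_pre N d0) (hom_pre N d1) ->
  exact_at (hom_pre N' d1) (hom_pre N' d2) ->
  exact_at (hom_pre N'' d0) (hom_pre N'' d1).
Proof.
move=> proj1 proj2 iinj ip psurj d01 d12 exN exN' y.
split=> [y0|[x <-]]; last exact: hom_pre_comp0.
have [f fE] := proj1 _ _ p (hom_fun y) psurj.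
have [|g gE] := projective_lift (u := f \o d1) proj2 ip.
  by move=> x; rewrite /= fE -[LHS]/(hom_fun (hom_pre N'' d1 y) x) y0.
have [|h hE] := (exN' (g : Hom P2 N')).1.
  apply: homP => x; apply: iinj; rewrite -[LHS]/(i (g (d2 x))) gE.
  by rewrite -[RHS]/(i 0) linear0 /= d12 linear0.
have [|k kE] := (exN ((f \- (i \o hom_fun h)) : {linear _ -> _})).1.
  apply: homP => x; rewrite -[LHS]/(f (d1 x) - i (hom_fun h (d1 x))).
  by rewrite -[hom_fun h _]/(hom_fun (hom_pre N' d1 h) x) hE gE subrr.
exists (p \o hom_fun k : {linear _ -> _}); apply: homP => x.
rewrite -[LHS]/(p (hom_fun (hom_pre N d0 k) x)) kE.
rewrite -[LHS]/(p (f x - i (hom_fun h x))) linearB fE.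
by rewrite (_ : p (i _) = 0) ?subr0 //; apply/ip; eexists.
Qed.

Lemma hom_exact_free n (P0 P1 P2 : lmodType R)
    (d0 : {linear P1 -> P0}) (d1 : {linear P2 -> P1}) :
  (forall x, d0 (d1 x) = 0) ->
  exact_at (hom_pre R^o d0) (hom_pre R^o d1) ->
  exact_at (hom_pre {freeg 'I_n / R} d0) (hom_pre {freeg 'I_n / R} d1).
Proof.
move=> d01 exR y; split=> [y0|[x <-]]; last exact: hom_pre_comp0.
have coordE k : exists w, hom_pre R^o d0 w
    = (linear_of (@coeff_is_linear R n k) \o hom_fun y : {linear _ -> _}).
  apply/exR; apply: homP => x.
  rewrite -[LHS]/(coeff k (hom_fun (hom_pre _ d1 y) x)) y0.
  exact: coeff0.
have [w wE] := choice coordE.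
have ul : linear (fun x =>
    \sum_k hom_fun (w k) x *: (<< k >> : {freeg 'I_n / R})).
  move=> a x x'; rewrite scaler_sumr -big_split; apply: eq_bigr => k _.
  by rewrite linearP scalerDl -scalerA.
exists (linear_of ul); apply: homP => x.
rewrite -[LHS]/(\sum_k hom_fun (w k) (d0 x) *: << k >>).
rewrite [RHS](freeg_ord_sumE (hom_fun y x)); apply: eq_bigr => k _.
by rewrite -[hom_fun (w k) _]/(hom_fun (hom_pre R^o d0 (w k)) x) wE.
Qed.

Lemma hom_exact_retract N (F : lmodType R) (s : {linear N -> F})
    (r : {linear F -> N})
    (P0 P1 P2 : lmodType R)
    (d0 : {linear P1 -> P0}) (d1 : {linear P2 -> P1}) :
  (forall x, r (s x) = x) -> (forall x, d0 (d1 x) = 0) ->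
  exact_at (hom_pre F d0) (hom_pre F d1) ->
  exact_at (hom_pre N d0) (hom_pre N d1).
Proof.
move=> rs d01 exF y; split=> [y0|[x <-]]; last exact: hom_pre_comp0.
have [|w wE] := (exF (s \o hom_fun y : {linear _ -> _})).1.
  apply: homP => x; rewrite -[LHS]/(s (hom_fun (hom_pre N d1 y) x)) y0.
  exact: linear0.
exists (r \o hom_fun w : {linear _ -> _}); apply: homP => x.
rewrite -[LHS]/(r (hom_fun (hom_pre F d0 w) x)) wE.
exact: rs.
Qed.

(** A resolution of length n gives Ext^{n+1}(C, S) = 0 for S the syzygy of index n+1. On the finite
    free resolution, the cover of S is a cocycle, hence factors through the differential; the factor
    splits the inclusion of S. *)
Lemma pd_le_fsyz_retract (Rnoeth : noetherian_ring R) (C : lmodType R) n :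
  finitely_generated C -> pd_le C n ->
  exists r : {linear ffres C n -> fsyz C n.+1},
    forall x, r (submod_val (kermod (finite_cover (fsyz C n))) x) = x.
Proof.
move=> Cfg [P [e [eta [projP etaS ex0 exP P0]]]].
have resG := ffres_resolution Rnoeth Cfg.
have resP : projective_resolution e eta by [].
have [_ _ _ exG] := resG.
have exN : exact_at (hom_pre (fsyz C n.+1) (e n))
                    (hom_pre (fsyz C n.+1) (e n.+1)).
  (* The term of degree n+1 of the short resolution is zero, so every [y] is zero. *)
  move=> y; split=> [_|[x <-]].
    exists 0; rewrite linear0; apply: homP => x.
    by rewrite (P0 n.+1 (ltnSn n) x) !linear0.
  by apply: hom_pre_comp0 => z; apply/exP; exists z.
have [|r rE] := (hom_exact_resolution resG resP exN
  (finite_cover (fsyz C n.+1) : Hom _ _)).1.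
  apply: homP => x; apply: val_inj.
  by rewrite -[LHS]/(ffres_d C n (ffres_d C n.+1 x)); apply/exG; exists x.
exists (hom_fun r) => x.
have [y <-] := finite_cover_surj (fsyz_fg Rnoeth n.+1 Cfg) x.
by rewrite -[LHS]/(hom_fun (hom_pre (fsyz C n.+1) (ffres_d C n) r) y) rE.
Qed.

(** Descending induction on the syzygies of [C]: the one of index n+1 is a direct summand of a
    finite free module, and [hom_exact_shift] passes from each to the previous one. *)
Lemma hom_exact_pd_finite (Rnoeth : noetherian_ring R) (X C : lmodType R)
    (P : nat -> lmodType R) (d : forall i, {linear P i.+1 -> P i})
    (eps : {linear P 0 -> X}) n0 :
  projective_resolution d eps -> finitely_generated C -> pd_finite C ->
  (forall j, (n0 <= j)%N ->
     exact_at (hom_pre R^o (d j)) (hom_pre R^o (d j.+1))) ->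
  forall j, (n0 <= j)%N ->
     exact_at (hom_pre C (d j)) (hom_pre C (d j.+1)).
Proof.
move=> [projP _ _ exP] Cfg [n pdC] exR.
have dd j x : d j (d j.+1 x) = 0 by apply/exP; exists x.
have exF j m : (n0 <= j)%N ->
    exact_at (hom_pre {freeg 'I_m / R} (d j))
             (hom_pre {freeg 'I_m / R} (d j.+1)).
  by move=> j0; apply: hom_exact_free; [exact: dd | exact: exR].
have [r rE] := pd_le_fsyz_retract Rnoeth Cfg pdC.
(* The counter runs from the split syzygy, k = 0, to [C] itself, k = n+1. The bound [n0] is kept, as
   degree j only calls on degree j+1 for the next syzygy. *)
suff exS k : (k <= n.+1)%N -> forall j, (n0 <= j)%N ->
    exact_at (hom_pre (fsyz C (n.+1 - k)) (d j))
             (hom_pre (fsyz C (n.+1 - k)) (d j.+1)).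
  by have := exS n.+1 (leqnn _); rewrite subnn.
elim: k => [_|k IHk kn] j j0.
  by rewrite subn0; apply: (hom_exact_retract rE); [exact: dd | exact: exF].
have := IHk (ltnW kn) j.+1 (leq_trans j0 (leqnSn _)).
rewrite -(subnSK kn); set m := (n.+1 - k.+1)%N => exm.
apply: (@hom_exact_shift (fsyz C m.+1) (ffres C m) (fsyz C m)
  (submod_val (kermod (finite_cover (fsyz C m)))) (finite_cover (fsyz C m))
  _ _ _ _ (d j) (d j.+1) (d j.+2)) => //.
- exact: val_inj.
- move=> y; split=> [/eqP y0|[x <-]]; first by exists (Sub y y0).
  by apply/eqP; exact: (valP x).
- exact: finite_cover_surj (fsyz_fg Rnoeth m Cfg).
- exact: exF.
Qed.

End ExtCoefficients.

(** * Vanishing of Ext and Tor, and the test property *)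

Section Vanishing.
Context {R : comNzRingType}.
Implicit Types X M N C : lmodType R.

Lemma fres_d_comp0 X n x : fres_d X n (fres_d X n.+1 x) = 0.
Proof. by apply/fres_exact; exists x. Qed.

Lemma Ext_eq0 X N n :
  is_zero (Ext n.+1 X N) <->
  exact_at (hom_pre N (fres_d X n)) (hom_pre N (fres_d X n.+1)).
Proof. by apply: homology_eq0; apply: hom_pre_comp0; exact: fres_d_comp0. Qed.

Lemma Tor_eq0 M X n :
  is_zero (Tor n.+1 M X) <->
  exact_at (tensor_map M (fres_d X n.+1)) (tensor_map M (fres_d X n)).
Proof.
by apply: homology_eq0; apply: tensor_map_comp0; exact: fres_d_comp0.
Qed.

(** [Ext] and [Tor] are defined by the large resolution [fres], while Hom evaluation needs finite
    free terms: Ext is moved to [ffres], turned into Tor with each Hom(C, I^k), shifted to [M], and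
    moved back. *)
Lemma Tor_eq0_Cid (Rnoeth : noetherian_ring R) C M X n0 :
  finitely_generated X -> Cid_finite C M ->
  (forall j, (n0 <= j)%N -> is_zero (Ext j.+1 X C)) ->
  forall j, (n0 <= j)%N -> is_zero (Tor j.+1 M X).
Proof.
move=> Xfg [n [I [i [d [injI iinj ex0 ex I0]]]]] extX j j0; apply/Tor_eq0.
have resG := ffres_resolution Rnoeth Xfg.
have resX := fres_resolution X.
have [_ _ _ exG] := resG.
have ee k x : ffres_d X k (ffres_d X k.+1 x) = 0 by apply/exG; exists x.
apply: (tensor_exact_resolution resX resG).
apply: (@tensor_exact_coresolution _ (fun i => projT1 (gens (fsyz X i)))
  (ffres_d X) ee n0 n.+1 M (fun k => Hom C (I k)) i d) => // k.
  by move=> nk y; apply: homP => x; exact: I0.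
move=> l l0; apply: (tensor_exact_of_hom_exact (injI k) (ee l)).
by apply: (hom_exact_resolution resG resX); apply/Ext_eq0; exact: extX.
Qed.

Lemma pd_finite_of_test (Rnoeth : noetherian_ring R) C M X n0 :
  test_module M -> Cid_finite C M -> finitely_generated X ->
  (forall j, (n0 <= j)%N -> is_zero (Ext j.+1 X C)) -> pd_finite X.
Proof.
move=> [_ testM] CidM Xfg extX; case: (pselect (pd_finite X)) => // pdX.
(* Asking for a degree at least n0+1 excludes degree 0 and yields a successor j+1 with n0 <= j. *)
have [[|j] [//= j0 torj]] := testM X Xfg pdX n0.+1.
by case: torj; exact: (Tor_eq0_Cid Rnoeth Xfg CidM extX).
Qed.

End Vanishing.

Theorem proposition4p12 (R : comNzRingType)
  (R_noetherian : noetherian_ring R) (R_local : local_ring R)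
  (C : lmodType R) (C_semidualizing : semidualizing C)
  (M : lmodType R) (M_nonzero : ~ is_zero M)
  (M_fg : finitely_generated M) (M_test : test_module M)
  (M_Cid : Cid_finite C M)
  (X : lmodType R) (X_fg : finitely_generated X)
  (X_ext : exists n0 : nat, forall i : nat, (n0 <= i)%N ->
             is_zero (Ext i X (R^o))) :
  pd_finite X.
Proof.
have [C_fg _ C_ext] := C_semidualizing; have [n0 X_ext0] := X_ext.
have C_pd : pd_finite C.
  (* The self-extensions of [C] vanish in every positive degree, so the bound is 0. *)
  apply: (pd_finite_of_test R_noetherian M_test M_Cid C_fg (n0 := 0%N)).
  by move=> j _; exact: C_ext.
apply: (pd_finite_of_test R_noetherian M_test M_Cid X_fg (n0 := n0)).
(* The coefficients change from R to [C] at the level of the complexes on [fres X]. *)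
move=> j j0; apply/Ext_eq0; move: j j0.
apply: (hom_exact_pd_finite R_noetherian (fres_resolution X) C_fg C_pd).
by move=> j j0; apply/Ext_eq0/X_ext0/leqW.
Qed.
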